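(* Let $Q(x,y)=ax^2+hxy+by^2$ be a binary quadratic form with integer coefficients $a,h,b$, and let $\Lambda_Q(\xi)$ and $\Lambda(\xi)$ be the Lyapunov exponents defined in the context. (i) If $Q$ is indefinite and represents zero (that is, $Q(x,y)=0$ for some $(x,y)\in\mathbb{Z}^2\setminus\{(0,0)\}$), then $\Lambda_Q(\xi)=2\Lambda(\xi)$ for all $\xi\in\mathbb{R}P^1=\mathbb{R}\cup\{\infty\}$. (ii) If $Q$ is a nonzero semidefinite form with zero discriminant ($h^2-4ab=0$), then likewise $\Lambda_Q(\xi)=2\Lambda(\xi)$ for all $\xi\in\mathbb{R}P^1$.
   Context: Let $L=\begin{pmatrix}1&1\\0&1\end{pmatrix}$ and $R=\begin{pmatrix}1&0\\1&1\end{pmatrix}$. Paths and matrices. For $\xi\in[0,\infty]$ with continued fraction expansion $\xi=[c_0,c_1,c_2,\ldots]=c_0+\cfrac{1}{c_1+\cfrac{1}{c_2+\cdots}}$ ($c_0\ge 0$ and $c_i\geq 1$ for $i\ge1$, all integers), the path $\gamma_\xi$ in the planar binary rooted (Farey) tree makes $c_0$ left turns, then $c_1$ right turns, then $c_2$ left turns, and so on. The matrix $A_n(\xi)$ is the product, from left to right, of the first $n$ letters of the infinite word $L^{c_0}R^{c_1}L^{c_2}R^{c_3}\cdots$ (with $A_0=I$). If $\xi=[c_0,\ldots,c_m]\ge 0$ is rational, the word is completed to the infinite word $L^{c_0}R^{c_1}\cdots X^{c_m}Y^{\infty}$, where $\{X,Y\}=\{L,R\}$ and the letters alternate (either of the two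 finite continued fraction expansions of $\xi$ with admissible entries may be used). In particular, the word for $\xi=0$ is $R^\infty$, and the word for $\xi=\infty$ is $L^\infty$. For $\xi<0$ with $-\xi=[c_0,c_1,c_2,\ldots]$, the path $\gamma_\xi$ is the reflected path, and $A_n(\xi)$ is the product of the first $n$ letters of the word $(L^{-1})^{c_0}(R^{-1})^{c_1}(L^{-1})^{c_2}(R^{-1})^{c_3}\cdots$, completed in the same way for rational $\xi$. The exponent $\Lambda$. Let $\rho(A)$ denote the spectral radius of a matrix $A$ (the maximum modulus of its eigenvalues). Then $$\Lambda(\xi)=\limsup_{n\to\infty}\frac{\ln\rho(A_n(\xi))}{n}.$$ The exponent $\Lambda_Q$. Let $u_n,v_n\in\mathbb{Z}^2$ be the first and second columns of $A_n(\xi)$. The $n$-th topographic triple $(a_n(\xi),b_n(\xi),c_n(\xi))$ of $Q$ along $\gamma_\xi$ consists of the values of $Q$ on the $n$-th superbase on the path: $a_n=Q(u_n)$, $b_n=Q(v_n)$, and $c_n=Q(u_n+v_n)$ if $\xi\in[0,\infty]$, $c_n=Q(u_n-v_n)$ if $\xi<0$. Put $|Q_n(\xi)|=\max(|a_n(\xi)|,|b_n(\xi)|,|c_n(\xi)|)$. Then $$\Lambda_Q(\xi)=\limsup_{n\to\infty}\frac{\ln|Q_n(\xi)|}{n}.$$ *)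

(* Defs.v *)
From HB Require Import structures.
From mathcomp Require Import all_boot all_order all_algebra.
From mathcomp Require Import complex.
From mathcomp Require Import all_classical all_reals all_analysis.
From mathcomp Require Import ring lra.

Set Implicit Arguments.
Unset Strict Implicit.
Unset Printing Implicit Defensive.

Import Order.TTheory GRing.Theory Num.Theory.
Import numFieldNormedType.Exports.

Local Open Scope classical_set_scope.
Local Open Scope ring_scope.

(* R P^1 = R u {oo} is [option R], with [None] for oo. *)

Inductive cfrac : Type :=
| CFfin of seq nat
| CFinf of (nat -> nat).

(* [c0, ..., cm] = c0 + 1/(c1 + ... + 1/cm); the innermost term is
   cm + 0^-1 = cm since 0^-1 = 0. *)
Definition cf_value (R : realType) (s : seq nat) : R :=
  foldr (fun c x => c%:R + x^-1) 0 s.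

Definition cf_represents (R : realType) (x : R) (e : cfrac) : Prop :=
  match e with
  | CFfin s => [/\ s != [::], all (leq 1) (behead s) & cf_value R s = x]
  | CFinf c => (forall i, (0 < c i.+1)%N) /\
               (fun n => cf_value R (mkseq c n.+1)) @ \oo --> x
  end.

(* A real xi is described by any admissible expansion of |xi| (so a rational
   number has two of them, except 0); xi = oo has the empty expansion. *)
Definition expansion (R : realType) (xi : option R) (e : cfrac) : Prop :=
  if xi is Some x then cf_represents `|x| e else e = CFfin [::].

Section Existence.
Variable R : realType.

Let subDl (u v w : R) : u + v - (u + w) = v - w. Proof. by ring. Qed.

Let F (s : seq nat) (y : R) := foldr (fun c x => c%:R + x^-1) y s.

Let F_ge1 s y : all (leq 1) s -> 1 <= y -> 1 <= F s y.
Proof.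
elim: s => //= c s IH /andP[c1 /IH{}IH] /IH Fy.
by rewrite ler_wpDr ?invr_ge0 ?ler1n // (le_trans ler01).
Qed.

Let F_contract s y z : all (leq 1) s -> 1 <= y -> 1 <= z ->
  `|F s y - F s z| <= 2 * 2^-1 ^+ size s * `|y - z|.
Proof.
move=> + y1 z1; have [n] := ubnP (size s); elim: n s => // n IH [|c [|c' s]] /=.
- by move=> _ _; rewrite expr0 mulr1; have := normr_ge0 (y - z); lra.
- move=> _ _; rewrite expr1 mulfV ?mul1r // subDl.
  have -> : y^-1 - z^-1 = (z - y) / (y * z) by field; apply/andP; split; lra.
  rewrite normrM distrC ler_piMr // normfV invf_le1 ger0_norm; nra.
move=> sn /and3P[_ c'1 s1].
have /IH/(_ s1) : (size s < n)%N by exact: ltnW.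
have := F_ge1 s1 y1; have := F_ge1 s1 z1.
set Y := F s y; set Z := F s z => Z1 Y1 YZ; rewrite subDl.
have c1 : 1 <= c'%:R :> R by rewrite ler1n.
have -> : (c'%:R + Y^-1)^-1 - (c'%:R + Z^-1)^-1 =
          (Y - Z) / ((c'%:R * Y + 1) * (c'%:R * Z + 1)).
  by field; rewrite !lt0r_neq0 //; nra.
have YZ4 : 4 <= (c'%:R * Y + 1) * (c'%:R * Z + 1).
  have : 2 <= c'%:R * Y + 1 by nra.
  have : 2 <= c'%:R * Z + 1 by nra.
  nra.
rewrite normrM normfV (gtr0_norm (lt_le_trans _ YZ4)) // ler_pdivrMr; last lra.
apply: (le_trans YZ); rewrite !exprS.
have : 0 <= 2^-1 ^+ size s * `|y - z| by rewrite mulr_ge0 ?exprn_ge0.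
set D := _ * (_ + 1) in YZ4 *; set t := 2^-1 ^+ _; set d := `|y - z| => td0.
have -> : 2 * (2^-1 * (2^-1 * t)) * d * D = 2 * t * d * (4^-1 * D) by field.
by rewrite ler_peMr -?mulrA; lra.
Qed.

Let quo (x : R) (n : nat) := iter n (fun t => (t - (Num.truncn t)%:R)^-1) x.
Let dig x n := Num.truncn (quo x n).
Let rem x n := quo x n - (dig x n)%:R.

Let rem_itv x n : 0 <= x -> (forall i, (i < n)%N -> rem x i != 0) ->
  [/\ 0 <= quo x n, 0 <= rem x n < 1 & (0 < n)%N -> 1 <= quo x n].
Proof.
move=> x0; elim: n => [|n IH] rn.
  by split=> //; have := truncn_itv x0; rewrite /rem /dig /quo /= -natr1; lra.
have [|q0 /andP[r0 r1] _] := IH; first by move=> i /ltnW/rn.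
have rn0 : 0 < rem x n by rewrite lt0r rn.
have q1 : 1 <= quo x n.+1 by rewrite /quo iterS -/(rem x n) invf_ge1// ltW.
have {}q0 : 0 <= quo x n.+1 by lra.
by split=> //; have := truncn_itv q0; rewrite /rem /dig -natr1; lra.
Qed.

Let F_quo x n : (forall i, (i < n)%N -> rem x i != 0) ->
  F (mkseq (dig x) n) (quo x n) = x.
Proof.
elim: n => [//|n IH] rn.
rewrite /mkseq -addn1 iotaD map_cat /F foldr_cat /= add0n addn1.
rewrite [quo x n.+1]iterS -/(quo x n) invrK addrC subrK.
by apply: IH => i /ltnW/rn.
Qed.

Let cf_valueE x n : cf_value R (mkseq (dig x) n.+1) = F (mkseq (dig x) n) (dig x n)%:R.
Proof.
rewrite /cf_value /mkseq -[in LHS]addn1 iotaD map_cat foldr_cat /= add0n.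
by rewrite invr0 addr0.
Qed.

Let dig_gt0 x i : 0 <= x -> (forall j, (j < i.+1)%N -> rem x j != 0) ->
  (0 < dig x i.+1)%N.
Proof. by move=> x0 /(rem_itv x0)[_ _ /(_ isT)]; rewrite truncn_gt0. Qed.

Let cf_represents_ex (x : R) : 0 <= x -> exists e, cf_represents x e.
Proof.
move=> x0; have [rat|/forallNP nrat] := pselect (exists i, rem x i == 0).
  case: (ex_minnP rat) => m /eqP rm0 mmin.
  have rn i : (i < m)%N -> rem x i != 0.
    by move=> im; apply: contraTneq im => /eqP/mmin; rewrite -leqNgt.
  exists (CFfin (mkseq (dig x) m.+1)); split=> //.
    change (all (leq 1) (map (dig x) (iota 1 m))).
    rewrite all_map; apply/allP => i; rewrite mem_iota => /andP[i0 im] /=.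
    by case: i i0 im => // i _ im; apply: dig_gt0 => // j ji; apply: rn; rewrite -ltnS (leq_ltn_trans ji).
  by rewrite cf_valueE -[RHS](F_quo rn); congr F; apply/esym/eqP; rewrite -subr_eq0; apply/eqP.
have irr i : rem x i != 0 by apply/negP/nrat.
exists (CFinf (dig x)); split=> [i|]; first by apply: dig_gt0.
have geo : (2 * 2^-1 ^+ n : R) @[n --> \oo] --> 0.
  by apply: cvg_geometric; rewrite ger0_norm; lra.
rewrite -cvg_shiftS; apply/cvgrPdist_le => e e0; near=> n.
apply: (@le_trans _ _ (2 * 2^-1 ^+ n)); last first.
  rewrite -[leLHS]ger0_norm ?mulr_ge0 ?exprn_ge0 //; near: n.
  exact: (cvgr0_norm_le _ geo).
change (`|x - cf_value R (mkseq (dig x) n.+2)| <= 2 * 2^-1 ^+ n); rewrite cf_valueE -[X in `|X - _|](@F_quo x n.+1) //.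
have s1 : all (leq 1) (map (dig x) (iota 1 n)).
  rewrite all_map; apply/allP => i; rewrite mem_iota => /andP[i0 _] /=.
  by case: i i0 => // i _; apply: dig_gt0.
have [_ + /(_ isT) q1] := rem_itv x0 (fun i (_ : (i < n.+1)%N) => irr i).
rewrite /rem => /andP[r0 r1].
have d1 : 1 <= (dig x n.+1)%:R :> R by rewrite ler1n dig_gt0.
have := F_contract s1 q1 d1; have := F_ge1 s1 q1; have := F_ge1 s1 d1.
rewrite size_map size_iota [F (mkseq _ _) _]/= [F (mkseq _ _) _]/= subDl -/(F _ _) -/(F _ _).
set A := F _ (quo x n.+1); set B := F _ _ => B1 A1 AB.
have -> : A^-1 - B^-1 = (B - A) / (A * B) by field; apply/andP; split; lra.
rewrite normrM distrC normfV (@ger0_norm _ (A * B)); last nra.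
rewrite ler_pdivrMr; last nra.
apply: (le_trans AB).
rewrite (@ger0_norm _ (quo x n.+1 - _)) //.
have t0 : 0 <= 2 * 2^-1 ^+ n :> R by rewrite mulr_ge0 ?exprn_ge0.
by apply: ler_wpM2l => //; nra.
Unshelve. all: by end_near. Qed.

Lemma expansion_ex (xi : option R) : exists e, expansion xi e.
Proof. by case: xi => [x|]; [exact: cf_represents_ex | exists (CFfin [::])]. Qed.

End Existence.

Definition negative (R : realType) (xi : option R) : bool :=
  if xi is Some x then x < 0 else false.

Inductive turn : Type := TL | TR.

Definition block_turn (k : nat) : turn := if odd k then TR else TL.

Definition cf_blocks (s : seq nat) : seq turn :=
  flatten [seq nseq (nth 0%N s k) (block_turn k) | k <- iota 0 (size s)].

(* The infinite word L^c0 R^c1 L^c2 ...; a finite expansion is completed by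
   repeating the turn following its last block (hence L^oo for [::]).  In the
   infinite case the blocks 0, ..., n+1 already contain at least n+1 letters
   since c_i >= 1 for i >= 1. *)
Definition cf_word (e : cfrac) (n : nat) : turn :=
  match e with
  | CFfin s => nth (block_turn (size s)) (cf_blocks s) n
  | CFinf c => nth TL (cf_blocks (mkseq c n.+2)) n
  end.

Definition Lmx : 'M[int]_2 :=
  \matrix_(i < 2, j < 2) (if (i == 1) && (j == 0) then 0 else 1).
Definition Rmx : 'M[int]_2 :=
  \matrix_(i < 2, j < 2) (if (i == 0) && (j == 1) then 0 else 1).

Definition turn_mx (neg : bool) (t : turn) : 'M[int]_2 :=
  let M := match t with TL => Lmx | TR => Rmx end in
  if neg then M^-1 else M.

Definition path_mx (R : realType) (xi : option R) (e : cfrac) (n : nat) :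
    'M[int]_2 :=
  \prod_(i < n) turn_mx (negative xi) (cf_word e i).

Definition spectral_radius (R : realType) (n : nat) (A : 'M[R[i]]_n) : R :=
  sup [set r : R | exists2 l : R[i], eigenvalue A l & r = complex.Re `|l|].

Definition Lambda (R : realType) (xi : option R) (e : cfrac) : \bar R :=
  limn_esup (fun n =>
    (ln (spectral_radius (map_mx (fun k : int => k%:~R : R[i])
                                 (path_mx xi e n))) / n%:R)%:E).

Definition qform (a h b : int) (v : 'cV[int]_2) : int :=
  a * v 0 0 ^+ 2 + h * v 0 0 * v 1 0 + b * v 1 0 ^+ 2.

Definition indefinite (a h b : int) : Prop :=
  (exists v, 0 < qform a h b v) /\ (exists v, qform a h b v < 0).

Definition represents_zero (a h b : int) : Prop :=
  exists2 v, v != 0 & qform a h b v = 0.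

Definition semidefinite (a h b : int) : Prop :=
  (forall v, 0 <= qform a h b v) \/ (forall v, qform a h b v <= 0).

Definition topo_norm (R : realType) (a h b : int) (xi : option R) (e : cfrac)
    (n : nat) : int :=
  let u := col 0 (path_mx xi e n) in
  let v := col 1 (path_mx xi e n) in
  let w := if negative xi then u - v else u + v in
  Num.max `|qform a h b u| (Num.max `|qform a h b v| `|qform a h b w|).

Definition LambdaQ (R : realType) (a h b : int) (xi : option R) (e : cfrac) :
    \bar R :=
  limn_esup (fun n => (ln ((topo_norm a h b xi e n)%:~R : R) / n%:R)%:E).

(* Main.v *)
Require Import Defs.
From mathcomp Require Import all_boot all_order all_algebra.
From mathcomp Require Import complex.
From mathcomp Require Import all_classical all_reals all_analysis.
From mathcomp Require Import ring lra zify.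
Import Order.TTheory GRing.Theory Num.Theory.
Import numFieldNormedType.Exports.
Local Open Scope classical_set_scope.
Local Open Scope ring_scope.

(** Both parts are instances of one fact: a nonzero integral form Q that
    represents zero satisfies LambdaQ = 2 Lambda along every infinite word in L
    and R ([LambdaQ_isotropic]). A form of zero discriminant represents zero:
    (h, -2a) is a zero, and (1, 0) is one when a = h = 0.

    A nonzero form with a zero splits: k Q = l l' for a positive integer k and
    nonzero integral linear forms l, l' ([isotropic_factors]). Hence |Q_n| is
    governed by the values of l and l' on the columns of A_n, and it suffices to
    see that such values are as large as the columns themselves.

    Suppose that both letters occur infinitely often in the word. The values
    (x, y) of l on the two columns evolve by (x, x + y) or (x + y, y). While x
    and y have opposite signs this is the subtractive Euclidean algorithm, so it
    ends, and eventually x and y have the same strict sign. From then on |x|,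
    |y| and the column sums of A_n obey the same recursion, whose coefficients
    are nonnegative, and their ratio stays bounded ([column_sums_le]).
    Geometrically: the columns converge to an irrational direction, which lies
    off the rational line l = 0. With l and l' this gives the growth of |Q_n|;
    with the two coordinate forms it gives that of the trace, because the
    diagonal entries of A_n are coordinates of its columns.

    If the word is eventually constant, the entries of A_n grow at most
    linearly, while k |Q_n| and the trace stay at least 1.

    In both cases |Q_n| and (tr A_n)^2 agree up to a factor K (n + 1)^2
    ([topo_norm_comparable]). As det A_n = 1, the spectral radius of A_n lies
    between half the trace and twice the trace ([spectral_radius_bounds]), so
    the same comparison holds with its square; and a polynomial factor does not
    change the upper limit of ln(.)/n ([limn_esup_ln_le]). A negative xi amounts
    to conjugating A_n by diag(1, -1), that is, to replacing h by -h. *)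

(** * Upper limits of logarithmic growth rates *)

Lemma limn_esup_le_near (R : realType) (f g : nat -> \bar R) :
  (forall eps : R, 0 < eps -> \forall n \near \oo, (f n <= g n + eps%:E)%E) ->
  (limn_esup f <= limn_esup g)%E.
Proof.
move=> fg; apply/lee_addgt0Pr => eps eps0; rewrite -leeBlDr//.
apply: le_ereal_inf_tmp => _ [A FA <-]; rewrite leeBlDr//.
pose V := A `&` [set n | (f n <= g n + eps%:E)%E].
apply: (@le_trans _ _ (ereal_sup (f @` V))).
  apply: ereal_inf_lbound; exists V => //.
  by apply: filterI => //; exact: fg.
apply: ge_ereal_sup => _ [n [An /= fgn] <-]; apply: (le_trans fgn).
by rewrite leeD2r//; apply: ereal_sup_ubound; exists n.
Qed.

Lemma limn_esup_pZl (R : realType) (r : R) (f : nat -> \bar R) : 0 < r ->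
  (limn_esup (fun n => r%:E * f n) = r%:E * limn_esup f)%E.
Proof.
move=> r0; rewrite /limn_esup /limf_esup -ereal_inf_pZl//; congr ereal_inf.
rewrite image_comp; apply: eq_imagel => A _ /=.
by rewrite -ereal_sup_pZl// image_comp.
Qed.

(** A polynomial factor contributes o(n) to the logarithm. For the exponent 2,
    ln(n + 1) <= d (n + 1) - ln d for every d > 0, since ln x < x at
    x = d (n + 1). *)
Lemma limn_esup_ln_le (R : realType) (K : R) (f g : nat -> R) :
  0 < K ->
  (\forall n \near \oo, [/\ 0 < f n, 0 < g n & f n <= K * n.+1%:R ^+ 2 * g n]) ->
  (limn_esup (fun n => (ln (f n) / n%:R)%:E) <=
   limn_esup (fun n => (ln (g n) / n%:R)%:E))%E.
Proof.
move=> K0 fg; apply: limn_esup_le_near => eps eps0.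
(* With d = eps / 4, the term 2 d n is half of eps n, and C collects the terms
   independent of n, which the other half absorbs once n >= 2 C / eps. *)
pose C := ln K + 2 * (eps / 4) - 2 * ln (eps / 4).
near=> n.
have [f0 g0 le_fg] : [/\ 0 < f n, 0 < g n & f n <= K * n.+1%:R ^+ 2 * g n].
  by near: n.
have n0 : 0 < n%:R :> R by rewrite ltr0n; near: n; exact: nbhs_infty_gt.
have Cn : 2 * C / eps <= n%:R by near: n; exact: nbhs_infty_ger.
rewrite -EFinD lee_fin ler_pdivrMr// mulrDl divfK ?lt0r_neq0//.
have e4 : 0 < eps / 4 by rewrite divr_gt0.
have n1 : 0 < n.+1%:R :> R by rewrite ltr0Sn.
have lnn : ln (n.+1%:R : R) <= eps / 4 * n.+1%:R - ln (eps / 4).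
  have := @ln_sublinear R (eps / 4 * n.+1%:R) (mulr_gt0 e4 n1).
  by rewrite lnM ?posrE// => /ltW; lra.
have : ln (f n) <= ln (K * n.+1%:R ^+ 2 * g n).
  by rewrite ler_ln// ?posrE// !mulr_gt0// exprn_gt0.
rewrite expr2 !lnM ?posrE ?mulr_gt0// => lef.
apply: (le_trans lef); rewrite ler_pdivrMr// in Cn.
rewrite -natr1 in lnn *; rewrite /C in Cn; nra.
Unshelve. all: by end_near. Qed.

(** * The spectral radius of a 2 x 2 matrix of determinant 1 *)

Lemma eigenvalue_mx2 (F : fieldType) (A : 'M[F]_2) (l : F) :
  eigenvalue A l = (l ^+ 2 - \tr A * l + \det A == 0).
Proof.
rewrite eigenvalue_root_char /root; congr (_ == _).
have szA := size_char_poly A.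
rewrite horner_coef szA !big_ord_recl big_ord0 /= !/bump /= !add1n.
have := char_poly_monic A; rewrite monicE lead_coefE szA => /eqP ->.
have /= -> := @char_poly_trace F 2 A isT.
by rewrite char_poly_det sqrrN !expr1n; ring.
Qed.

(** Every root of X^2 - t X + 1 satisfies |l|^2 <= t |l| + 1, hence |l| <= 2 t,
    and for t >= 2 the root (t + sqrt(t^2 - 4)) / 2 is real and at least t / 2. *)
Lemma spectral_radius_bounds (R : realType) (A : 'M[R[i]]_2) (t : R) :
  2 <= t -> \tr A = t%:C%C -> \det A = 1 ->
  t / 2 <= spectral_radius A <= 2 * t.
Proof.
move=> t2 trA detA; rewrite /spectral_radius.
set S := [set r | _].
have ubS : ubound S (2 * t).
  move=> _ [l + ->]; rewrite eigenvalue_mx2 trA detA => /eqP lE.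
  have : (`|l| ^+ 2 <= t%:C%C * `|l| + 1)%R.
    rewrite -normrX; have -> : l ^+ 2 = t%:C%C * l - 1.
      by apply/eqP; rewrite -subr_eq0 -lE; apply/eqP; ring.
    apply: (le_trans (ler_normB _ _)); rewrite normrM normr1 lerD2r.
    by rewrite ger0_norm// lecR; lra.
  rewrite normc_def; set s := Num.sqrt _.
  have s0 : 0 <= s by exact: sqrtr_ge0.
  rewrite -rmorphXn -rmorphM -(rmorph1 (real_complex R)) -rmorphD lecR => ss /=.
  by nra.
pose l := (t + Num.sqrt (t ^+ 2 - 4)) / 2.
have sq0 : 0 <= Num.sqrt (t ^+ 2 - 4) by exact: sqrtr_ge0.
have sqE : Num.sqrt (t ^+ 2 - 4) ^+ 2 = t ^+ 2 - 4 by rewrite sqr_sqrtr//; nra.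
have lt2 : t / 2 <= l by rewrite /l; lra.
have Sl : S l.
  exists l%:C%C; last by rewrite ger0_norm// lecR; lra.
  rewrite eigenvalue_mx2 trA detA -rmorphXn -rmorphM -rmorphB.
  rewrite -(rmorph1 (real_complex R)) -rmorphD.
  have -> : l ^+ 2 - t * l + 1 = 0 by rewrite /l; lra.
  by rewrite rmorph0.
apply/andP; split.
  by apply: (le_trans lt2); apply: ub_le_sup => //; exists (2 * t).
by apply: ge_sup => //; exists l.
Qed.

(** * Linear forms along a word *)

Definition turn_step (t : turn) (z : int * int) : int * int :=
  match t with TL => (z.1, z.1 + z.2) | TR => (z.1 + z.2, z.2) end.

(** The values that the linear form with coefficients z takes on the two columns
    of A_n: right multiplication by L or R replaces a column by the sum of both.
    The coefficients (1, 0) and (0, 1) give the rows of A_n, and (1, 1) its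
    column sums. *)
Fixpoint column_values (w : nat -> turn) (z : int * int) (n : nat) : int * int :=
  if n is m.+1 then turn_step (w m) (column_values w z m) else z.

Lemma column_values_neq0 (w : nat -> turn) (z : int * int) n :
  z != (0, 0) -> column_values w z n != (0, 0).
Proof.
move=> z0; elim: n => //= n; case: (column_values w z n) => x y.
case: (w n) => /=; rewrite !xpair_eqE; lia.
Qed.

Lemma column_values_linear (w : nat -> turn) (z : int * int) n :
  let p := column_values w (1, 0) n in let q := column_values w (0, 1) n in
  column_values w z n = (z.1 * p.1 + z.2 * q.1, z.1 * p.2 + z.2 * q.2).
Proof.
elim: n => [|n /= ->]; first by case: z => x y /=; congr pair; lia.
by case: (w n) => /=; congr pair; ring.
Qed.

Lemma column_values_basis (w : nat -> turn) n :
  [/\ 1 <= (column_values w (1, 0) n).1, 0 <= (column_values w (1, 0) n).2,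
      0 <= (column_values w (0, 1) n).1 & 1 <= (column_values w (0, 1) n).2].
Proof.
elim: n => [//|n /=].
case: (column_values w (1, 0) n) => p r.
case: (column_values w (0, 1) n) => q s /=.
by case: (w n) => /= -[*]; split; lia.
Qed.

Lemma column_sums_gt0 (w : nat -> turn) n :
  0 < (column_values w (1, 1) n).1 /\ 0 < (column_values w (1, 1) n).2.
Proof.
rewrite column_values_linear /=; have [] := column_values_basis w n.
case: (column_values w (1, 0) n) => p r.
case: (column_values w (0, 1) n) => q s /=.
by move=> *; split; lia.
Qed.

(** * Words with infinitely many turns of both kinds *)

Definition recurrent (w : nat -> turn) :=
  forall t m, exists2 n, (m <= n)%N & w n = t.

Lemma not_recurrent w :
  ~ recurrent w -> exists t m, forall n, (m <= n)%N -> w n = t.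
Proof.
move=> /existsNP[t /existsNP[m wm]].
exists (if t is TL then TR else TL), m => n mn.
by case E : (w n); case: t wm => // wm; case: wm; exists n.
Qed.

Lemma recurrent_first w t m : recurrent w ->
  exists2 n, (m <= n)%N & w n = t /\ forall i, (m <= i < n)%N -> w i <> t.
Proof.
move=> /(_ t m)[n]; elim/ltn_ind: n => n IH mn wn.
have [[i /andP[mi i_n] wi]|none] := pselect (exists2 i, (m <= i < n)%N & w i = t).
  exact: (IH i).
by exists n => //; split=> // i mi wi; apply: none; exists i.
Qed.

(** A turn changes one value only, by adding the other one to it; when the added
    value is zero nothing moves until the other kind of turn occurs. *)
Lemma column_values_run (w : nat -> turn) (z : int * int) t m n : (m <= n)%N ->
  (forall i, (m <= i < n)%N -> w i <> t) ->
  (if t is TL then (column_values w z m).2 else (column_values w z m).1) = 0 ->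
  column_values w z n = column_values w z m.
Proof.
move=> mn + z0; elim: n mn => [|n IH]; first by rewrite leqn0 => /eqP ->.
rewrite leq_eqVlt => /orP[/eqP <-//|mn] wt /=; rewrite IH//; last first.
  by move=> i /andP[mi i_n]; apply: wt; rewrite mi ltnW.
move: z0; have := wt n; rewrite -ltnS mn ltnSn => /(_ isT).
by case: (column_values w z m) => x y; case: (w n); case: t {IH wt} => //= _ ->;
  rewrite ?addr0 ?add0r.
Qed.

(** As long as the two values have strictly opposite signs, a turn replaces one of
    them by a value that either has the sign of the other (and the claim holds)
    or is smaller in modulus, so |x| + |y| decreases. If a value is zero, the next
    turn that adds to it the other, nonzero, value gives two equal values. *)
Lemma column_values_same_sign (w : nat -> turn) (z : int * int) :
  recurrent w -> z != (0, 0) ->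
  exists n, 0 < (column_values w z n).1 * (column_values w z n).2.
Proof.
move=> rw z0.
suff: forall (k : nat) m,
    `|(column_values w z m).1| + `|(column_values w z m).2| < k%:Z ->
    exists n, 0 < (column_values w z n).1 * (column_values w z n).2.
  set d := `|(column_values w z 0).1| + `|(column_values w z 0).2|.
  move=> /(_ `|d|.+1 0%N); apply; rewrite -/d -addn1 PoszD gez0_abs ?ltrDl//.
elim=> [m|k IH m]; first by lia.
have := @column_values_neq0 w z m z0.
case E : (column_values w z m) => [x y] /= xy0 xyk; rewrite xpair_eqE in xy0.
have [x0|x0] := eqVneq x 0.
  have [n mn [wn wi]] := @recurrent_first w TR m rw.
  have := @column_values_run w z TR m n mn wi; rewrite E => /(_ x0) En.
  exists n.+1; rewrite /= wn En /= x0 add0r -expr2 exprn_even_gt0//=.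
  by move: xy0; rewrite x0 eqxx.
have [y0|y0] := eqVneq y 0.
  have [n mn [wn wi]] := @recurrent_first w TL m rw.
  have := @column_values_run w z TL m n mn wi; rewrite E => /(_ y0) En.
  by exists n.+1; rewrite /= wn En /= y0 addr0 -expr2 exprn_even_gt0.
have [xy|xy] := ltP 0 (x * y); first by exists m; rewrite E.
have [xy'|xy'] :=
    ltP 0 ((column_values w z m.+1).1 * (column_values w z m.+1).2).
  by exists m.+1.
apply: (IH m.+1); move: xy'; rewrite /= E.
have [[? ?]|[? ?]] : 0 < x /\ y < 0 \/ x < 0 /\ 0 < y.
- case: (ltgtP x 0) x0 => // x0 _; case: (ltgtP y 0) y0 => // y0 _; nia.
- by case: (w m) => /= xy';
    [have : x + y <= 0 by nia|have : 0 <= x + y by nia]; lia.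
- by case: (w m) => /= xy';
    [have : 0 <= x + y by nia|have : x + y <= 0 by nia]; lia.
Qed.

(** Once the two values have the same sign, |x + y| = |x| + |y|: the moduli follow
    the same recursion as the column sums, so a domination is inherited. *)
Lemma column_sums_le_persist (w : nat -> turn) (z : int * int)
    (K : int) m n :
  (m <= n)%N -> 0 <= K ->
  0 < (column_values w z m).1 * (column_values w z m).2 ->
  `|(column_values w (1, 1) m).1| <= K * `|(column_values w z m).1| ->
  `|(column_values w (1, 1) m).2| <= K * `|(column_values w z m).2| ->
  [/\ 0 < (column_values w z n).1 * (column_values w z n).2,
    `|(column_values w (1, 1) n).1| <= K * `|(column_values w z n).1| &
    `|(column_values w (1, 1) n).2| <= K * `|(column_values w z n).2|].
Proof.
move=> + K0 zm m1 m2; elim: n => [|n IH]; first by rewrite leqn0 => /eqP <-.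
rewrite leq_eqVlt => /orP[/eqP <-//|/IH[]] /=.
case: (column_values w z n) => x y; case: (column_values w (1, 1) n) => c d /=.
move=> xy cx dy.
have xyD : `|x + y| = `|x| + `|y| by nia.
by case: (w n) => /=; split=> //; rewrite ?xyD; nia.
Qed.

(** The limiting direction of the columns is irrational here, so no rational line
    comes near them: a linear form is bounded below by a multiple of the size of
    the column. *)
Lemma column_sums_le (w : nat -> turn) (z : int * int) :
  recurrent w -> z != (0, 0) ->
  exists K : int, 0 < K /\ exists N, forall n, (N <= n)%N ->
    `|(column_values w (1, 1) n).1| <= K * `|(column_values w z n).1| /\
    `|(column_values w (1, 1) n).2| <= K * `|(column_values w z n).2|.
Proof.
move=> rw z0; have [N zN] := column_values_same_sign w z rw z0.
have persist K := @column_sums_le_persist w z K N.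
move: zN persist; case: (column_values w z N) => x y.
case: (column_values w (1, 1) N) => c d /= xy persist.
have x1 : 1 <= `|x| by have [x0|] := eqVneq x 0; [rewrite x0 mul0r in xy|lia].
have y1 : 1 <= `|y| by have [y0|] := eqVneq y 0; [rewrite y0 mulr0 in xy|lia].
exists (1 + `|c| + `|d|); split; first lia.
by exists N => n Nn; have [||||_] // := persist (1 + `|c| + `|d|) n Nn; nia.
Qed.

(** * Comparison of the trace and of products of forms with the column sums *)

Lemma tail_linear_growth (w : nat -> turn) (t : turn) N :
  (forall n, (N <= n)%N -> w n = t) ->
  exists K : int, 0 < K /\ forall n, (N <= n)%N ->
    (column_values w (1, 1) n).1 + (column_values w (1, 1) n).2 <= K * n.+1%:Z.
Proof.
move=> wt.
have [c0 d0] := column_sums_gt0 w N.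
case E : (column_values w (1, 1) N) c0 d0 => [c d] /= c0 d0.
exists (c + d); split; first lia; move=> n Nn.
suff : (column_values w (1, 1) n).1 + (column_values w (1, 1) n).2 <=
         c + d + n%:Z * (if t is TL then c else d) /\
       (if t is TL then (column_values w (1, 1) n).1 = c
        else (column_values w (1, 1) n).2 = d).
  have nc : 0 <= n%:Z * c by rewrite mulr_ge0// ltW.
  have nd : 0 <= n%:Z * d by rewrite mulr_ge0// ltW.
  by case: (column_values w (1, 1) n) => c' d' /=; case: (t) => -[+ _]; lia.
elim: n Nn => [|n IH].
  rewrite leqn0 => /eqP N0; move: E; rewrite N0 => ->.
  by case: (t); split => /=; lia.
rewrite leq_eqVlt => /orP[/eqP NS|Nn].
  by rewrite -NS E; case: (t); split => //=; nia.
have [] := IH Nn; rewrite /= (wt n)//.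
by case: (column_values w (1, 1) n) => c' d'; case: (t) => /= h e;
  rewrite e in h *; split=> //; lia.
Qed.

(** The largest modulus, over a superbase of columns u, v, u + v, of a product of
    two linear forms with values z and z' on (u, v). *)
Definition product_norm (z z' : int * int) : int :=
  Num.max `|z.1 * z'.1| (Num.max `|z.2 * z'.2| `|(z.1 + z.2) * (z'.1 + z'.2)|).

(** The diagonal entries are the values of the first coordinate form on the first
    column and of the second one on the second column. *)
Lemma column_sum_le_trace (w : nat -> turn) :
  exists K : int, 0 < K /\ exists N, forall n, (N <= n)%N ->
    (column_values w (1, 1) n).1 + (column_values w (1, 1) n).2 <=
    K * n.+1%:Z * ((column_values w (1, 0) n).1 + (column_values w (0, 1) n).2).
Proof.
have [rw|] := pselect (recurrent w); last first.
  move=> /not_recurrent[t [N /tail_linear_growth[K [K0 KN]]]].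
  exists K; split=> //; exists N => n /KN KNn; apply: (le_trans KNn).
  rewrite ler_peMr//; first nia.
  have [+ _ _ +] := column_values_basis w n.
  by move: (column_values w (1, 0) n).1 (column_values w (0, 1) n).2 => p s; lia.
have [K [K0 [N KN]]] := column_sums_le w (1, 0) rw isT.
have [K' [K'0 [N' K'N]]] := column_sums_le w (0, 1) rw isT.
exists (K + K'); split; first lia; exists (maxn N N') => n.
rewrite geq_max => /andP[/KN[+ _] /K'N[_ +]].
have [] := column_values_basis w n.
move: (column_values w (1, 0) n).1 (column_values w (0, 1) n).2 => p s p1 _ _ s1.
case: (column_values w (1, 1) n) => c d /= cp ds.
apply: (@le_trans _ _ ((K + K') * (p + s))); first by nia.
by rewrite ler_wpM2r//; [lia | rewrite ler_peMr//; lia].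
Qed.

(** If x x' = y y' = 0 with (x, y) and (x', y') nonzero, then one form vanishes
    on u only and the other one on v only, so the product at u + v is nonzero. *)
Lemma product_norm_ge1 (z z' : int * int) :
  z != (0, 0) -> z' != (0, 0) -> 1 <= product_norm z z'.
Proof.
case: z z' => [x y] [x' y']; rewrite !xpair_eqE /product_norm /= => z0 z'0.
rewrite !le_max -!gtz0_ge1 !normr_gt0 !mulf_eq0.
have [x0|x0] := eqVneq x 0; have [y0|y0] := eqVneq y 0;
have [x'0|x'0] := eqVneq x' 0; have [y'0|y'0] := eqVneq y' 0 => //=; lia.
Qed.

(** The factor (n + 1)^2 is there for eventually constant words, where the column
    sums grow linearly and the product of the two forms may stay bounded. *)
Lemma column_sum_le_product_norm (w : nat -> turn) (z z' : int * int) :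
  z != (0, 0) -> z' != (0, 0) ->
  exists K : int, 0 < K /\ exists N, forall n, (N <= n)%N ->
    ((column_values w (1, 1) n).1 + (column_values w (1, 1) n).2) ^+ 2 <=
    K * n.+1%:Z ^+ 2 * product_norm (column_values w z n) (column_values w z' n).
Proof.
move=> z0 z'0.
have [rw|] := pselect (recurrent w); last first.
  move=> /not_recurrent[t [N /tail_linear_growth[K [K0 KN]]]].
  exists (K ^+ 2); split; first by rewrite exprn_gt0.
  exists N => n /KN KNn; rewrite -exprMn.
  have V1 := product_norm_ge1 _ _ (column_values_neq0 w _ n z0)
                               (column_values_neq0 w _ n z'0).
  apply: (@le_trans _ _ ((K * n.+1%:Z) ^+ 2)); last by rewrite ler_peMr// sqr_ge0.
  have [c0 d0] := column_sums_gt0 w n.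
  rewrite ler_sqr ?nnegrE; last by rewrite mulr_ge0// ltW.
  - exact: KNn.
  - by rewrite addr_ge0// ltW.
have [K [K0 [N KN]]] := column_sums_le w z rw z0.
have [K' [K'0 [N' K'N]]] := column_sums_le w z' rw z'0.
exists (4 * (K * K')); split; first by rewrite !mulr_gt0.
exists (maxn N N') => n; rewrite geq_max => /andP[/KN[+ +] /K'N[+ +]].
have [+ +] := column_sums_gt0 w n; rewrite /product_norm.
case: (column_values w (1, 1) n) => c d; case: (column_values w z n) => x y.
case: (column_values w z' n) => x' y' /= c0 d0.
rewrite (gtr0_norm c0) (gtr0_norm d0) => cx dy cx' dy'.
set V := Num.max _ _.
have xV : `|x| * `|x'| <= V by rewrite -normrM le_max lexx.
have yV : `|y| * `|y'| <= V by rewrite -normrM !le_max lexx orbT.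
have cV : c ^+ 2 <= K * K' * V.
  apply: (@le_trans _ _ ((K * `|x|) * (K' * `|x'|))).
    by apply: ler_pM => //; exact: ltW.
  by rewrite mulrACA ler_wpM2l// mulr_ge0// ltW.
have dV : d ^+ 2 <= K * K' * V.
  apply: (@le_trans _ _ ((K * `|y|) * (K' * `|y'|))).
    by apply: ler_pM => //; exact: ltW.
  by rewrite mulrACA ler_wpM2l// mulr_ge0// ltW.
have sq : (c + d) ^+ 2 <= 4 * (K * K' * V).
  by have := sqr_ge0 (c - d); rewrite sqrrB sqrrD; lia.
have V0 : 0 <= V by apply: le_trans xV; rewrite mulr_ge0.
apply: (le_trans sq); rewrite mulrA ler_wpM2r// ler_peMr ?exprn_ege1//.
by rewrite !mulr_ge0// ltW.
Qed.

Lemma product_norm_le_column_sum (w : nat -> turn) (z z' : int * int) :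
  exists K : int, 0 < K /\ forall n,
    product_norm (column_values w z n) (column_values w z' n) <=
    K * ((column_values w (1, 1) n).1 + (column_values w (1, 1) n).2) ^+ 2.
Proof.
pose B (z : int * int) := 1 + `|z.1| + `|z.2|.
have BP (u : int * int) n (c := column_values w (1, 1) n) (s := c.1 + c.2) :
    [/\ `|(column_values w u n).1| <= B u * s,
      `|(column_values w u n).2| <= B u * s &
      `|(column_values w u n).1 + (column_values w u n).2| <= B u * s].
  rewrite /s /c !(column_values_linear w u) (column_values_linear w (1, 1)) /= /B.
  have [] := column_values_basis w n.
  case: u => x y; case: (column_values w (1, 0) n) => p r.
  case: (column_values w (0, 1) n) => q t /= p1 r0 q0 t1.
  have bd (a b : int) : 0 <= a -> 0 <= b -> a <= p + r -> b <= q + t ->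
      `|x * a + y * b| <= (1 + `|x| + `|y|) * (1 * p + 1 * q + (1 * r + 1 * t)).
    move=> a0 b0 ap bq; apply: (le_trans (ler_normD _ _)); rewrite !normrM.
    rewrite (ger0_norm a0) (ger0_norm b0); nia.
  split; [apply: bd; lia|apply: bd; lia|].
  have -> : x * p + y * q + (x * r + y * t) = x * (p + r) + y * (q + t) by ring.
  by apply: bd; lia.
exists (B z * B z'); split; first by rewrite /B; nia.
move=> n; have [a1 a2 a3] := BP z n; have [b1 b2 b3] := BP z' n.
set s := _ + _ in a1 a2 a3 b1 b2 b3 *.
have -> : B z * B z' * s ^+ 2 = (B z * s) * (B z' * s) by ring.
by rewrite /product_norm !ge_max !normrM !ler_pM.
Qed.

(** * Path matrices and the splitting of isotropic forms *)

Lemma turn_mx_entries (neg : bool) (t : turn) :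
  turn_mx neg t = \matrix_(i < 2, j < 2)
    (if i == j then 1
     else if (i == 0) == (if t is TL then true else false) then (-1) ^+ neg
     else 0).
Proof.
pose N (s : bool) (t : turn) : 'M[int]_2 := \matrix_(i < 2, j < 2)
  (if i == j then 1
   else if (i == 0) == (if t is TL then true else false) then (-1) ^+ s else 0).
have N0 s : turn_mx false s = N false s.
  by apply/matrixP => -[[|[|//]] ?] [[|[|//]] ?]; case: s; rewrite /= !mxE.
case: neg; last exact: N0.
have -> : turn_mx true t = (N false t)^-1 by rewrite -N0.
have NN : N false t *m N true t = 1.
  by apply/matrixP => -[[|[|//]] ?] [[|[|//]] ?]; case: t;
    rewrite !mxE !big_ord_recl big_ord0 !mxE.
have [uN _] := mulmx1_unit NN.
by rewrite -[RHS](mulKr uN) [_ * N true t]NN; exact: esym (mulr1 _).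
Qed.

(** The inverse letters are the conjugates of L and R by diag(1, -1), which
    accounts for the signs of the off-diagonal entries. *)
Lemma path_mx_entries (R : realType) (xi : option R) (e : cfrac) n :
  [/\ path_mx xi e n 0 0 = (column_values (cf_word e) (1, 0) n).1,
      path_mx xi e n 0 1 =
        (-1) ^+ negative xi * (column_values (cf_word e) (1, 0) n).2,
      path_mx xi e n 1 0 =
        (-1) ^+ negative xi * (column_values (cf_word e) (0, 1) n).1
    & path_mx xi e n 1 1 = (column_values (cf_word e) (0, 1) n).2].
Proof.
elim: n => [|n]; rewrite /path_mx.
  by rewrite big_ord0 !mxE /= !mulr0.
rewrite big_ord_recr -/(path_mx xi e n) /= => -[IH00 IH01 IH10 IH11].
rewrite !mxE !big_ord_recl !big_ord0 turn_mx_entries !mxE.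
have -> : lift ord0 ord0 = 1 :> 'I_2 by exact/val_inj.
rewrite IH00 IH01 IH10 IH11.
case: (column_values _ (1, 0) n) => p r; case: (column_values _ (0, 1) n) => q s.
by case: (negative xi); case: (cf_word e n); split;
  rewrite /= ?expr1 ?expr0; ring.
Qed.

(** A zero (x, y) makes the form divisible by y X - x Y over the rationals; the
    cofactor is (a y X + (a x + h y) Y) / y^2. If y = 0 then a = 0, and the form is
    Y (h X + b Y). *)
Lemma isotropic_factors (a h b x y : int) :
  (a, h, b) != (0, 0, 0) -> (x, y) != (0, 0) ->
  a * x ^+ 2 + h * x * y + b * y ^+ 2 = 0 ->
  exists (k : int) (z z' : int * int), [/\ 0 < k, z != (0, 0), z' != (0, 0) &
    forall X Y : int, k * (a * X ^+ 2 + h * X * Y + b * Y ^+ 2) =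
                (z.1 * X + z.2 * Y) * (z'.1 * X + z'.2 * Y)].
Proof.
rewrite !xpair_eqE => abh0 xy0 Q0.
have [y0|y0] := eqVneq y 0.
  have x0 : x != 0 by move: xy0; rewrite y0 eqxx andbT.
  have a0 : a = 0.
    move: Q0; rewrite y0 !(mulr0, expr0n, addr0) /= => /eqP.
    by rewrite mulf_eq0 sqrf_eq0 (negPf x0) orbF => /eqP.
  exists 1, (0, 1), (h, b); split=> //=.
    by move: abh0; rewrite a0 eqxx !xpair_eqE.
  by move=> X Y; rewrite a0; ring.
exists (y ^+ 2), (y, - x), (a * y, a * x + h * y); split.
- by rewrite exprn_even_gt0.
- by rewrite xpair_eqE (negPf y0).
- rewrite xpair_eqE mulf_eq0 (negPf y0) orbF.
  apply: contra abh0 => /andP[/eqP a0].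
  rewrite a0 mul0r add0r mulf_eq0 (negPf y0) orbF => /eqP h0.
  move: Q0; rewrite a0 h0 !mul0r !add0r => /eqP.
  by rewrite mulf_eq0 sqrf_eq0 (negPf y0) orbF => ->.
move=> X Y /=; apply/eqP; rewrite -subr_eq0.
rewrite [X in X == 0](_ : _ = (a * x ^+ 2 + h * x * y + b * y ^+ 2) * Y ^+ 2).
  by rewrite Q0 mul0r.
by ring.
Qed.

(** For a path with inverse letters the second coordinates change sign relative to
    the first ones, so the form to split is the one with h multiplied by the sign
    eps of the path, whose zero is (v_0, eps v_1). *)
Lemma topo_norm_factors (R : realType) (a h b : int) (xi : option R)
    (e : cfrac) :
  (a, h, b) != (0, 0, 0) -> represents_zero a h b ->
  exists (k : int) (z z' : int * int), [/\ 0 < k, z != (0, 0), z' != (0, 0) &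
    forall n, k * topo_norm a h b xi e n =
      product_norm (column_values (cf_word e) z n)
                   (column_values (cf_word e) z' n)].
Proof.
move=> abh0 [v v0 Qv]; pose eps : int := (-1) ^+ negative xi.
have [k [z [z' [k0 z0 z'0 kQ]]]] : exists (k : int) (z z' : int * int),
    [/\ 0 < k, z != (0, 0), z' != (0, 0) & forall X Y : int,
      k * (a * X ^+ 2 + h * X * (eps * Y) + b * (eps * Y) ^+ 2) =
      (z.1 * X + z.2 * Y) * (z'.1 * X + z'.2 * Y)].
  have [|||k [z [z' [k0 z0 z'0 kQ]]]] :=
    @isotropic_factors a (h * eps) b (v 0 0) (eps * v 1 0).
  - by move: abh0; rewrite !xpair_eqE mulf_eq0 signr_eq0 orbF.
  - apply: contra v0.
    rewrite xpair_eqE mulf_eq0 signr_eq0 /= => /andP[/eqP v00 /eqP v10].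
    apply/eqP/matrixP => -[[|[|//]] i2] j; rewrite ord1 mxE.
      by rewrite -[RHS]v00; congr (v _ _); exact/val_inj.
    by rewrite -[RHS]v10; congr (v _ _); exact/val_inj.
  - rewrite -[RHS]Qv /qform /eps.
    by case: (negative xi); rewrite ?expr1 ?expr0; ring.
  exists k, z, z'; split=> // X Y; rewrite -kQ; congr (k * _).
  by rewrite /eps; case: (negative xi); rewrite ?expr1 ?expr0; ring.
exists k, z, z'; split=> // n.
have [A00 A01 A10 A11] := path_mx_entries R xi e n.
rewrite /topo_norm /product_norm.
rewrite (column_values_linear _ z) (column_values_linear _ z') /=.
move: A00 A01 A10 A11; rewrite -/eps.
case: (column_values _ (1, 0) n) => p r.
case: (column_values _ (0, 1) n) => q s /= A00 A01 A10 A11.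
have normk (t : int) : k * `|t| = `|k * t| by rewrite normrM gtr0_norm.
rewrite !maxr_pMr ?(ltW k0)// !normk /qform.
have -> : (if negative xi then col 0 (path_mx xi e n) - col 1 (path_mx xi e n)
           else col 0 (path_mx xi e n) + col 1 (path_mx xi e n)) =
          col 0 (path_mx xi e n) + eps *: col 1 (path_mx xi e n).
  rewrite /eps; case: (negative xi).
    by rewrite expr1 scaleN1r.
  by rewrite expr0 scale1r.
have Qp := kQ p q; have Qr := kQ r s; have Qpr := kQ (p + r) (q + s).
have regroup (u : int * int) :
    u.1 * p + u.2 * q + (u.1 * r + u.2 * s) = u.1 * (p + r) + u.2 * (q + s).
  by rewrite !mulrDr addrACA.
rewrite !mxE A00 A01 A10 A11 !regroup -Qp -Qr -Qpr /eps.
by congr Num.max; last congr Num.max; congr (`|_|); case: (negative xi);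
  rewrite /= ?expr1z ?expr0z; ring.
Qed.

Lemma path_mx_trace (R : realType) (xi : option R) (e : cfrac) n :
  \tr (path_mx xi e n) = (column_values (cf_word e) (1, 0) n).1 +
                         (column_values (cf_word e) (0, 1) n).2.
Proof.
have [A00 _ _ A11] := path_mx_entries R xi e n.
rewrite /mxtrace !big_ord_recl big_ord0 addr0 -A00 -A11.
by congr (_ + path_mx _ _ _ _ _); exact/val_inj.
Qed.

Lemma path_mx_det (R : realType) (xi : option R) (e : cfrac) n :
  \det (path_mx xi e n) = 1.
Proof.
rewrite /path_mx; elim/big_rec: _ => [|i A _ IH]; first by rewrite det1.
rewrite [\det _]det_mulmx IH mulr1 turn_mx_entries.
rewrite (expand_det_row _ ord0) !big_ord_recl big_ord0 /cofactor.
rewrite !det_mx11 !mxE /=.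
by case: (cf_word e i); case: (negative xi).
Qed.

(** * Comparison of the exponents *)

(** Both quantities are compared with m^2, m being the sum of the entries of A_n. *)
Lemma topo_norm_comparable (R : realType) (a h b : int) (xi : option R)
    (e : cfrac) :
  (a, h, b) != (0, 0, 0) -> represents_zero a h b ->
  exists K : int, 0 < K /\ exists N, forall n, (N <= n)%N ->
    [/\ 1 <= topo_norm a h b xi e n,
        topo_norm a h b xi e n <=
          K * n.+1%:Z ^+ 2 * \tr (path_mx xi e n) ^+ 2 &
        \tr (path_mx xi e n) ^+ 2 <=
          K * n.+1%:Z ^+ 2 * topo_norm a h b xi e n].
Proof.
move=> abh0 rep0; set w := cf_word e.
have [k [z [z' [k0 z0 z'0 kQ]]]] := topo_norm_factors R a h b xi e abh0 rep0.
have [K1 [K10 [N1 le_tr]]] := column_sum_le_trace w.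
have [K2 [K20 [N2 le_pair]]] := column_sum_le_product_norm w z z' z0 z'0.
have [K3 [K30 pair_le]] := product_norm_le_column_sum w z z'.
exists (K3 * K1 ^+ 2 + K2 * k); split.
  by rewrite addr_gt0// mulr_gt0// exprn_gt0.
exists (maxn N1 N2) => n; rewrite geq_max => /andP[/le_tr + /le_pair].
have := pair_le n; rewrite -kQ path_mx_trace -/w.
have := product_norm_ge1 _ _ (column_values_neq0 w _ n z0)
                             (column_values_neq0 w _ n z'0).
rewrite -kQ; have [+ + + +] := column_values_basis w n.
have := column_values_linear w (1, 1) n => /= ->.
case: (column_values w (1, 0) n) => p r.
case: (column_values w (0, 1) n) => q s /=.
rewrite !mul1r; set V := topo_norm _ _ _ _ _ _; set m := _ + _ + _; set t := p + s.
set y := n.+1%:Z => p1 r0 q0 s1 kV1 VM mt mV.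
have V1 : 1 <= V by nia.
have m0 : 0 <= m by rewrite /m; lia.
have tm : t <= m by rewrite /m /t; lia.
have t0 : 0 <= t by rewrite /t; lia.
have y0 : 0 <= y by [].
have y2 : 0 <= y ^+ 2 by rewrite sqr_ge0.
split=> //.
  have VkV : V <= k * V by rewrite ler_peMl//; lia.
  have m2 : m ^+ 2 <= (K1 * y * t) ^+ 2.
    by rewrite ler_sqr ?nnegrE ?mulr_ge0// ltW.
  apply: (le_trans VkV); apply: (le_trans VM).
  apply: (le_trans (ler_wpM2l (ltW K30) m2)).
  rewrite [leLHS](_ : _ = K3 * K1 ^+ 2 * y ^+ 2 * t ^+ 2); last by ring.
  by rewrite ler_wpM2r ?sqr_ge0// ler_wpM2r// lerDl mulr_ge0// ltW.
have t2 : t ^+ 2 <= m ^+ 2 by rewrite ler_sqr ?nnegrE.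
apply: (le_trans t2); apply: (le_trans mV).
rewrite [leLHS](_ : _ = K2 * k * y ^+ 2 * V); last by ring.
rewrite ler_wpM2r//; first by lia.
by rewrite ler_wpM2r// lerDr mulr_ge0 ?sqr_ge0// ltW.
Qed.

Lemma LambdaQ_isotropic (R : realType) (a h b : int) (xi : option R)
    (e : cfrac) :
  (a, h, b) != (0, 0, 0) -> represents_zero a h b ->
  LambdaQ a h b xi e = (2%:E * Lambda xi e)%E.
Proof.
move=> abh0 rep0.
have [K [K0 [N KN]]] := topo_norm_comparable R a h b xi e abh0 rep0.
rewrite /LambdaQ /Lambda -limn_esup_pZl//.
pose rho n := spectral_radius
  (map_mx (fun k : int => k%:~R : R[i]) (path_mx xi e n)).
pose t n : R := (\tr (path_mx xi e n))%:~R.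
pose f n : R := (topo_norm a h b xi e n)%:~R.
have t2 n : 2 <= t n.
  rewrite /t path_mx_trace -[leLHS]/(2%:~R) ler_int.
  by have [p1 _ _ s1] := column_values_basis (cf_word e) n; exact: lerD p1 s1.
have rhot n : t n / 2 <= rho n <= 2 * t n.
  apply: spectral_radius_bounds; first exact: t2.
    by rewrite trace_map_mx /t rmorph_int.
  by rewrite det_map_mx path_mx_det rmorph1.
have rho0 n : 0 < rho n by have := t2 n; have /andP[] := rhot n; lra.
have -> : (fun n => 2%:E * (ln (rho n) / n%:R)%:E)%E =
          (fun n => (ln (rho n ^+ 2) / n%:R)%:E).
  apply/funext => n; rewrite -EFinM lnXn//; congr EFin.
  by rewrite mulr2n; ring.
have comparable n : (N <= n)%N -> [/\ 0 < f n, 0 < rho n ^+ 2,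
   f n <= (4 * K%:~R) * n.+1%:R ^+ 2 * rho n ^+ 2 &
   rho n ^+ 2 <= (4 * K%:~R) * n.+1%:R ^+ 2 * f n].
  move=> /KN[Q1 Qt tQ].
  have f0 : 0 < f n by rewrite ltr0z; apply: lt_le_trans Q1.
  have {}Qt : f n <= K%:~R * n.+1%:R ^+ 2 * t n ^+ 2.
    by move: Qt; rewrite -(ler_int R) !expr2 !intrM -pmulrn.
  have {}tQ : t n ^+ 2 <= K%:~R * n.+1%:R ^+ 2 * f n.
    by move: tQ; rewrite -(ler_int R) !expr2 !intrM -pmulrn.
  have /andP[le1 le2] := rhot n; have r0 := rho0 n; have tn := t2 n.
  have Kn0 : 0 <= K%:~R * n.+1%:R ^+ 2 :> R.
    by rewrite mulr_ge0 ?exprn_ge0// ler0z ltW.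
  split=> //; first by rewrite exprn_gt0.
    have : t n ^+ 2 <= 4 * rho n ^+ 2 by nra.
    by move=> /(ler_wpM2l Kn0)/(le_trans Qt); lra.
  have : rho n ^+ 2 <= 4 * t n ^+ 2 by nra.
  lra.
have K4 : 0 < 4 * K%:~R :> R by rewrite mulr_gt0// ltr0z.
apply/eqP; rewrite eq_le; apply/andP; split; apply: limn_esup_ln_le K4 _;
  by exists N => // n /comparable[].
Qed.

(** Q(h, -2a) = - a (h^2 - 4ab), and (h, -2a) is nonzero unless a = h = 0, in which
    case Q = b Y^2 vanishes at (1, 0). *)
Lemma discr0_represents_zero (a h b : int) :
  h ^+ 2 - 4 * a * b = 0 -> represents_zero a h b.
Proof.
move=> discr0.
have [ah0|ah0] := boolP ((a == 0) && (h == 0)).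
  exists (\col_i (if i == 0 then 1 else 0)).
    by apply/eqP => /colP /(_ 0); rewrite !mxE.
  by have /andP[/eqP -> /eqP ->] := ah0; rewrite /qform !mxE /=; ring.
exists (\col_i (if i == 0 then h else - 2 * a)).
  apply: contra ah0 => /eqP/colP v0.
  by have := v0 0; have := v0 1; rewrite !mxE /= => a0 ->; rewrite eqxx andbT; lia.
rewrite /qform !mxE /=.
rewrite (_ : _ + _ = - a * (h ^+ 2 - 4 * a * b)); last by ring.
by rewrite discr0 mulr0.
Qed.

Lemma indefinite_neq0 (a h b : int) : indefinite a h b -> (a, h, b) != (0, 0, 0).
Proof.
move=> [[v]]; rewrite /qform => Qv _; apply/eqP => -[a0 h0 b0].
by move: Qv; rewrite a0 h0 b0 !mul0r !addr0 ltxx.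
Qed.

Theorem proposition5 (R : realType) (a h b : int) :
  (indefinite a h b -> represents_zero a h b ->
     forall (xi : option R) (e : cfrac), expansion xi e ->
       LambdaQ a h b xi e = (2%:E * Lambda xi e)%E) /\
  ((a, h, b) != (0, 0, 0) -> semidefinite a h b -> h ^+ 2 - 4 * a * b = 0 ->
     forall (xi : option R) (e : cfrac), expansion xi e ->
       LambdaQ a h b xi e = (2%:E * Lambda xi e)%E).
Proof.
split=> [indef rep0 xi e _|abh0 _ discr0 xi e _].
  by apply: LambdaQ_isotropic => //; exact: indefinite_neq0.
by apply: LambdaQ_isotropic => //; exact: discr0_represents_zero.
Qed.
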